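(* Let $d\ge 1$ and let $(\mathbf W_s)_{s\in\mathbb Z}$ be a family of matrices in $\mathbb C^{d\times d}$ with $\mathbf W_0=\mathbf I_d$. The following are equivalent: (a) there exists a family $(\mathbf M_s)_{s\in\mathbb Z}$ of matrices in $\mathbb C^{d\times d}$ such that for all $s,t\in\mathbb Z$ and all $\mathbf q,\mathbf k\in\mathbb C^d$, $$\mathbf q^{\mathsf H}\mathbf W_{t-s}\mathbf k=(\mathbf M_s\mathbf q)^{\mathsf H}(\mathbf M_t\mathbf k);$$ (b) for all $s,t\in\mathbb Z$, $\mathbf W_{t-s}=\mathbf W_s^{\mathsf H}\mathbf W_t$, and $\mathbf W_t$ is a unitary matrix for every $t\in\mathbb Z$.
   Context: $\mathsf H$ denotes conjugate transposition and $\mathbf I_d$ is the $d\times d$ identity matrix. A relative positional encoding $f_{\mathrm{rel}}(\mathbf q_s,\mathbf k_t)=\mathbf q_s^{\mathsf H}\mathbf W_{t-s}\mathbf k_t$ (where $s,t$ are token positions and $\mathbf W_0=\mathbf I_d$) is called a linearized relative positional encoding when condition (a) holds. *)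

(* Defs.v *)
From mathcomp Require Export all_boot all_order all_algebra.
From mathcomp Require Export spectral reals.
From mathcomp.real_closed Require Export complex.

Open Scope ring_scope.
Open Scope sesquilinear_scope.

(* Main.v *)
Require Import Defs.

Import GRing.Theory.

(** Since [q] and [k] are arbitrary, (a) is the matrix identity W_{t-s} = M_s^H M_t
    ([sesqui_form_inj]). At s = t = 0 it makes M_0 unitary, and at s = 0 it gives W_t = M_0^H M_t:
    up to one fixed unitary factor, M is W. That factor cancels in W_s^H W_t. Conversely, M = W is a
    witness for (a). *)

Lemma conj_trmx_mul (C : numClosedFieldType) (m n p : nat)
    (A : 'M[C]_(m, n)) (B : 'M[C]_(n, p)) :
  (A *m B) ^t* = B ^t* *m A ^t*.
Proof. by rewrite trmx_mul map_mxM. Qed.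

(** Basis vectors e_i and e_j in place of [q] and [k] read off the entry (i, j). *)
Lemma sesqui_form_inj (C : numClosedFieldType) (m n : nat) (A B : 'M[C]_(m, n)) :
  (forall (q : 'cV[C]_m) (k : 'cV[C]_n), q ^t* *m A *m k = q ^t* *m B *m k) ->
  A = B.
Proof.
move=> eqAB; apply/matrixP => i j.
have := eqAB (delta_mx i 0) (delta_mx j 0).
rewrite trmx_delta map_delta_mx -!rowE -!colE => /matrixP/(_ 0 0).
by rewrite !mxE.
Qed.

(** [unitarymx] asks for A A^H = I; for square matrices a left inverse is also a right inverse. *)
Lemma unitarymxPl (C : numClosedFieldType) (n : nat) (A : 'M[C]_n) :
  A ^t* *m A = 1%:M -> A \is unitarymx.
Proof. by move=> /mulmx1C/unitarymxP. Qed.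

Theorem proposition3p2 (R : realType) (d : nat) (hd : (1 <= d)%N)
    (W : int -> 'M[R[i]]_d) (hW0 : W 0 = 1%:M) :
  (exists M : int -> 'M[R[i]]_d,
     forall (s t : int) (q k : 'cV[R[i]]_d),
       q ^t* *m W (t - s) *m k = (M s *m q) ^t* *m (M t *m k))
  <->
  ((forall s t : int, W (t - s) = (W s) ^t* *m W t) /\
   (forall t : int, W t \is unitarymx)).
Proof.
split=> [[M hM] | [hW _]]; last first.
  by exists W => s t q k; rewrite hW conj_trmx_mul !mulmxA.
have W_sub s t : W (t - s) = (M s) ^t* *m M t.
  by apply: sesqui_form_inj => q k; rewrite hM conj_trmx_mul !mulmxA.
have MhM : (M 0) ^t* *m M 0 = 1%:M by rewrite -W_sub subrr.
have W_M t : W t = (M 0) ^t* *m M t by rewrite -W_sub subr0.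
have WhW s t : W (t - s) = (W s) ^t* *m W t.
  (* The right side becomes M_s^H (M_0 M_0^H) M_t, whose middle factor is I because M_0 is
     square. *)
  rewrite W_sub !W_M conj_trmx_mul trmxCK mulmxA -(mulmxA _ (M 0)).
  by rewrite (mulmx1C MhM) mulmx1.
(* Unitarity is the diagonal case s = t: W_t^H W_t = W_0 = I. *)
by split=> // t; apply: unitarymxPl; rewrite -WhW subrr.
Qed.
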